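(* Let $\mathsf{G}$ be a connected weighted graph on $n\ge2$ vertices with Laplacian $A$, and let $\mathsf{G}_D$, with Laplacian $A_D\in\mathbb{R}^{N\times N}$, be obtained by disaggregating the first $m$ vertices of $\mathsf{G}$ into $d_1,\dots,d_m$ vertices. Let $\widetilde{P}=D_sP$. Let $\epsilon>0$ and suppose that for every $k=1,\dots,m$ every internal edge $e'=(p,q)\in E_a^k$ has weight $$\omega_{e'}\ \ge\ W_{e'}:=(1+\epsilon^{-1})\left[\sum_{\substack{e=(i,j)\in E_D^1\\ i\in V^0,\ j\in V_a^k}}\omega_eW_k^j+2\sum_{\ell=1}^m\left(\sum_{\substack{e=(i,j)\in E_D^2\\ i\in V_a^k,\ j\in V_a^\ell}}\omega_eW_k^i+\sum_{\substack{e=(i,j)\in E_D^2\\ i\in V_a^\ell,\ j\in V_a^k}}\omega_eW_k^j\right)\right].$$ Let $B_D\in\mathbb{R}^{N\times N}$ be symmetric positive definite (a preconditioner for $A_D$) and let $\widetilde{B}_D=D_sB_DD_s$. Then the preconditioner $B=\widetilde{P}^T\widetilde{B}_D\widetilde{P}$ for $A$ satisfies $$\kappa(BA)\le(1+\epsilon)\,\kappa(B_DA_D).$$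
   Context: All graphs are finite, simple, undirected, with positive edge weights $\omega_e$. The Laplacian $A$ of $\mathsf{G}=(V,E,\omega)$ is the symmetric matrix with $\langle A\bm{u},\bm{v}\rangle=\sum_{e=(i,j)\in E}\omega_e(u_i-u_j)(v_i-v_j)$. Disaggregating the vertices $1,\dots,m$ of $\mathsf{G}$ into $d_1,\dots,d_m$ vertices: vertex $k\le m$ is replaced by a set $V_a^k$ of $d_k$ new vertices, and the set $V^0$ of the remaining $n-m$ vertices is kept, so the new graph $\mathsf{G}_D$ has $N=n-m+\sum_k d_k$ vertices. Each edge of $\mathsf{G}$ gives exactly one edge of $\mathsf{G}_D$ of the same weight, where any endpoint $k\le m$ is replaced by one (arbitrarily chosen) vertex of $V_a^k$; in addition a connected graph $\mathsf{G}_a^k=(V_a^k,E_a^k,\omega_a^k)$ with positive edge weights (internal edges) is placed on each $V_a^k$. The vertices of $\mathsf{G}_D$ are ordered as $V_a^1,\dots,V_a^m$, then $V^0$. $P=\begin{pmatrix}P_m&0\\0&I_{(n-m)\times(n-m)}\end{pmatrix}\in\mathbb{R}^{N\times n}$, where $P_m$ is block diagonal with diagonal blocks the all-ones column vectors $\bm{1}_{d_1},\dots,\bm{1}_{d_m}$. $D_s=\operatorname{diag}(d_1^{-1/2}I_{d_1\times d_1},\dots,d_m^{-1/2}I_{d_m\times d_m},I_{(n-m)\times(n-m)})$. $E_D^1$ is the set of edges of $\mathsf{G}_D$ joining $V^0$ to some $V_a^k$ (written $(i,j)$ with $i\in V^0$); $E_D^2$ is the set of edges of $\mathsf{G}_D$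 joining $V_a^k$ to $V_a^\ell$ with $k\ne\ell$, each undirected edge being written once as a pair $(i,j)$ in an arbitrary fixed order. $L_k$ is the unweighted Laplacian of $\mathsf{G}_a^k$ (all edge weights set to $1$), $L_{k,j}=L_k+\bm{e}_j\bm{e}_j^T$ for $j\in V_a^k$ (with $\bm{e}_j$ the standard basis vector of $\mathbb{R}^{d_k}$; $L_{k,j}$ is invertible), and $W_k^j=\frac1{d_k^2}\|L_{k,j}^{-1}\bm{1}_{d_k}\|_{L_k}^2$, where $\|\bm{x}\|_{M}^2=\langle M\bm{x},\bm{x}\rangle$. For a product $BA$ of a symmetric positive definite $B$ and a nonzero symmetric positive semidefinite $A$, $\kappa(BA)$ is the ratio of the largest eigenvalue to the smallest nonzero eigenvalue of $BA$. *)

(* Defs.v *)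
From HB Require Import structures.
From mathcomp Require Import all_boot all_order all_algebra.
From mathcomp Require Import polyrcf.

Set Implicit Arguments.
Unset Strict Implicit.
Unset Printing Implicit Defensive.

Import Order.TTheory GRing.Theory Num.Theory.
Local Open Scope ring_scope.

(* Finite simple undirected graph on 'I_n with positive edge weights; the value
   of [wt x y] is meaningful only when [adj x y] holds. *)
Record wgraph (R : rcfType) (n : nat) := WGraph {
  adj : rel 'I_n;
  wt : 'I_n -> 'I_n -> R;
  adj_sym : symmetric adj;
  adj_irr : irreflexive adj;
  wt_sym : forall x y, wt x y = wt y x;
  wt_gt0 : forall x y, adj x y -> 0 < wt x y }.

Definition connected (R : rcfType) (n : nat) (G : wgraph R n) : Prop :=
  forall x y, connect (adj G) x y.

Definition unweighted (R : rcfType) (n : nat) (G : wgraph R n) : wgraph R n :=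
  @WGraph R n (adj G) (fun _ _ => 1) (adj_sym G) (adj_irr G)
    (fun _ _ => erefl) (fun _ _ _ => ltr01).

Definition edge_vec (R : rcfType) (n : nat) (i j : 'I_n) : 'cV[R]_n :=
  delta_mx i 0 - delta_mx j 0.

(* Each undirected edge is counted once, as the pair (i, j) with i < j. *)
Definition laplacian (R : rcfType) (n : nat) (G : wgraph R n) : 'M[R]_n :=
  \sum_(i < n) \sum_(j < n | (i < j)%N && adj G i j)
    wt G i j *: (edge_vec R i j *m (edge_vec R i j)^T).

Definition inner (R : rcfType) (n : nat) (x y : 'cV[R]_n) : R := (x^T *m y) 0 0.

Lemma tr_laplacian (R : rcfType) (n : nat) (G : wgraph R n) :
  (laplacian G)^T = laplacian G.
Proof.
rewrite /laplacian linear_sum; apply: eq_bigr => i _.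
rewrite linear_sum; apply: eq_bigr => j _.
by rewrite linearZ /= trmx_mul trmxK.
Qed.

Lemma inner_edge_vec (R : rcfType) (n : nat) (i j : 'I_n) (u : 'cV[R]_n) :
  ((edge_vec R i j)^T *m u) 0 0 = u i 0 - u j 0.
Proof.
by rewrite /edge_vec linearB /= !trmx_delta mulmxBl -!rowE !mxE.
Qed.

Lemma laplacianP (R : rcfType) (n : nat) (G : wgraph R n) (u v : 'cV[R]_n) :
  inner (laplacian G *m u) v =
  \sum_(i < n) \sum_(j < n | (i < j)%N && adj G i j)
    wt G i j * (u i 0 - u j 0) * (v i 0 - v j 0).
Proof.
rewrite /inner trmx_mul tr_laplacian /laplacian mulmx_sumr mulmx_suml summxE.
apply: eq_bigr => i _; rewrite mulmx_sumr mulmx_suml summxE.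
apply: eq_bigr => j _.
rewrite -scalemxAr -scalemxAl mxE -mulrA; congr (_ * _).
rewrite mulmxA -(mulmxA _ _ v) mxE big_ord1 inner_edge_vec.
by rewrite -(trmxK (u^T *m _)) trmx_mul trmxK mxE inner_edge_vec.
Qed.

Definition spd (R : rcfType) (n : nat) (M : 'M[R]_n) : Prop :=
  M^T = M /\ forall x : 'cV[R]_n, x != 0 -> 0 < inner (M *m x) x.

(* The eigenvalues in R of M, without repetition and in increasing order. *)
Definition spectrum (R : rcfType) (n : nat) (M : 'M[R]_n) : seq R :=
  rootsR (char_poly M).

Lemma mem_spectrum (R : rcfType) (n : nat) (M : 'M[R]_n) (x : R) :
  (x \in spectrum M) = eigenvalue M x.
Proof.
rewrite eigenvalue_root_char /spectrum.
by rewrite -roots_on_rootsR ?monic_neq0 ?char_poly_monic.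
Qed.

Lemma spectrum_sorted (R : rcfType) (n : nat) (M : 'M[R]_n) :
  sorted <%R (spectrum M).
Proof. exact: sorted_roots. Qed.

(* Largest eigenvalue over smallest nonzero eigenvalue.  The default 0 is
   irrelevant for a product of a positive definite and a nonzero positive
   semidefinite matrix: it is diagonalizable with real nonnegative eigenvalues,
   not all of them zero. *)
Definition kappa (R : rcfType) (n : nat) (M : 'M[R]_n) : R :=
  last 0 (spectrum M) / head 0 [seq x <- spectrum M | x != 0].

(* The original graph has m + r vertices, of which the first m are
   disaggregated; r is the number of vertices that are kept. *)
Definition Dsize (m r : nat) (d : 'I_m -> nat) : nat :=
  ((\sum_(k < m) d k) + r)%N.

(* Vertex p of V_a^k, inside the disaggregated graph. *)
Definition va (m r : nat) (d : 'I_m -> nat) (k : 'I_m) (p : 'I_(d k)) :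
  'I_(Dsize r d) := lshift r (tagnat.Rank k p).

(* Vertex i of V^0, inside the disaggregated graph. *)
Definition v0 (m r : nat) (d : 'I_m -> nat) (i : 'I_r) : 'I_(Dsize r d) :=
  rshift (\sum_(k < m) d k)%N i.

(* The original vertex from which a vertex stems. *)
Definition orig (m r : nat) (d : 'I_m -> nat) (a : 'I_(Dsize r d)) :
    'I_(m + r) :=
  match split a with
  | inl b => lshift r (tagnat.sig1 b)
  | inr i => rshift m i
  end.

Lemma orig_va (m r : nat) (d : 'I_m -> nat) (k : 'I_m) (p : 'I_(d k)) :
  orig (va r p) = lshift r k.
Proof. by rewrite /orig /va (unsplitK (inl _)) tagnat.Rank1K. Qed.

Lemma orig_v0 (m r : nat) (d : 'I_m -> nat) (i : 'I_r) :
  orig (v0 d i) = rshift m i.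
Proof. by rewrite /orig /v0 (unsplitK (inr _)). Qed.

(* GD is obtained from G by replacing each vertex k < m by the vertices of the
   connected graph Ga k.  The edges of GD between vertices of different origin
   correspond one-to-one, with their weights, to the edges of G. *)
Record disaggregation (R : rcfType) (m r : nat) (d : 'I_m -> nat)
    (G : wgraph R (m + r)) (Ga : forall k, wgraph R (d k))
    (GD : wgraph R (Dsize r d)) : Prop := Disaggregation {
  dis_pos : forall k, (0 < d k)%N;
  dis_conn : forall k, connected (Ga k);
  dis_int_adj : forall k (p q : 'I_(d k)),
    adj GD (va r p) (va r q) = adj (Ga k) p q;
  dis_int_wt : forall k (p q : 'I_(d k)), adj (Ga k) p q ->
    wt GD (va r p) (va r q) = wt (Ga k) p q;
  dis_ext : forall x y, adj G x y ->
    exists! e : 'I_(Dsize r d) * 'I_(Dsize r d),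
      [/\ orig e.1 = x, orig e.2 = y & adj GD e.1 e.2];
  dis_ext_adj : forall a b, adj GD a b -> orig a != orig b ->
    adj G (orig a) (orig b) /\ wt GD a b = wt G (orig a) (orig b) }.

Definition Pmx (R : rcfType) (m r : nat) (d : 'I_m -> nat) :
    'M[R]_(Dsize r d, m + r) :=
  block_mx (\mxcol_(k < m) \matrix_(p < d k, l < m) (l == k)%:R) 0 0 1%:M.

Definition Dsmx (R : rcfType) (m r : nat) (d : 'I_m -> nat) :
    'M[R]_(Dsize r d) :=
  block_mx (\mxdiag_(k < m) ((Num.sqrt (d k)%:R)^-1)%:M) 0 0 1%:M.

(* E2 lists each edge between two different aggregates exactly once, in an
   arbitrary order of its endpoints. *)
Record orients_cross_edges (R : rcfType) (m r : nat) (d : 'I_m -> nat)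
    (GD : wgraph R (Dsize r d))
    (E2 : {set 'I_(Dsize r d) * 'I_(Dsize r d)}) : Prop := OrientsCrossEdges {
  E2_cross : forall a b, (a, b) \in E2 ->
    exists k l (p : 'I_(d k)) (q : 'I_(d l)),
      [/\ k != l, a = va r p, b = va r q & adj GD a b];
  E2_once : forall k l (p : 'I_(d k)) (q : 'I_(d l)),
    k != l -> adj GD (va r p) (va r q) ->
    ((va r p, va r q) \in E2) (+) ((va r q, va r p) \in E2) }.

(* The quantity W_k^j of the graph H = G_a^k. *)
Definition Wcoef (R : rcfType) (d : nat) (H : wgraph R d) (j : 'I_d) : R :=
  let L := laplacian (unweighted H) in
  let x := invmx (L + delta_mx j j) *m const_mx 1 in
  (d%:R ^+ 2)^-1 * inner (L *m x) x.

(* The lower bound W_{e'}, common to all internal edges e' of G_a^k. *)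
Definition Wmin (R : rcfType) (m r : nat) (d : 'I_m -> nat)
    (Ga : forall k, wgraph R (d k)) (GD : wgraph R (Dsize r d))
    (E2 : {set 'I_(Dsize r d) * 'I_(Dsize r d)}) (eps : R) (k : 'I_m) : R :=
  (1 + eps^-1) *
  ((\sum_(i < r) \sum_(j < d k | adj GD (v0 d i) (va r j))
      wt GD (v0 d i) (va r j) * Wcoef (Ga k) j)
   + 2%:R * \sum_(l < m)
      ((\sum_(i < d k) \sum_(j < d l | (va r i, va r j) \in E2)
          wt GD (va r i) (va r j) * Wcoef (Ga k) i)
       + (\sum_(i < d l) \sum_(j < d k | (va r i, va r j) \in E2)
          wt GD (va r i) (va r j) * Wcoef (Ga k) j))).

(* Main.v *)
(* Write [Pi = (Ds^2 P)^T]: it replaces the values on each aggregate by their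
   average, [Pi P = 1], and the preconditioner is [B = Pi BD Pi^T].  An
   eigenvector [x] of [B A] with eigenvalue [a <> 0] gives [g = Pi^T x], and
   Rayleigh quotients of [BD AD] at [g] bound [a] from above by
   [(1 + eps) lambda_max], as soon as
   [|Pi u|_A^2 <= (1 + eps) |u|_AD^2], and from below by the least nonzero
   eigenvalue, by Cauchy-Schwarz and [|P v|_AD = |v|_A].
   For the energy estimate, on an external edge [(a, b)] the difference of the
   averages is [u_a - u_b] plus the difference of the deviations of [u_a] and
   [u_b] from their averages.  Young's inequality separates the two parts, and
   the squared deviations are bounded by the [Wcoef] times the unweighted
   internal energies, which the heavy internal edges absorb. *)
Require Import Defs.
From mathcomp Require Import all_boot all_order all_algebra.
From mathcomp Require Import complex ring lra.

Set Implicit Arguments.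
Unset Strict Implicit.
Unset Printing Implicit Defensive.

Import Order.TTheory GRing.Theory Num.Theory.
Local Open Scope ring_scope.

(** * Spectra of products of symmetric matrices *)

Section Inner.
Variables (R : rcfType) (n : nat).
Implicit Types (x y z : 'cV[R]_n) (M : 'M[R]_n).

Lemma innerC x y : inner x y = inner y x.
Proof. by rewrite /inner -[in LHS](trmxK y) -trmx_mul mxE. Qed.

Lemma innerDl x y z : inner (x + y) z = inner x z + inner y z.
Proof. by rewrite /inner linearD mulmxDl mxE. Qed.

Lemma innerZl a x y : inner (a *: x) y = a * inner x y.
Proof. by rewrite /inner linearZ -scalemxAl mxE. Qed.

Lemma innerDr x y z : inner x (y + z) = inner x y + inner x z.
Proof. by rewrite innerC innerDl !(innerC x). Qed.

Lemma innerZr a x y : inner x (a *: y) = a * inner x y.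
Proof. by rewrite innerC innerZl innerC. Qed.

Lemma inner0l y : inner 0 y = 0.
Proof. by rewrite /inner trmx0 mul0mx mxE. Qed.

Lemma inner_mull p (M : 'M[R]_(n, p)) (u : 'cV[R]_p) y :
  inner (M *m u) y = inner u (M^T *m y).
Proof. by rewrite /inner trmx_mul mulmxA. Qed.

Lemma inner_sum x y : inner x y = \sum_i x i 0 * y i 0.
Proof. by rewrite /inner mxE; apply: eq_bigr => i _; rewrite mxE. Qed.

(** The energy of [x + t *: y] is a nonnegative quadratic polynomial in [t]. As [M] is only
    semidefinite, its leading coefficient may vanish. *)
Lemma cauchy_schwarz M x y : M^T = M -> (forall u, 0 <= inner (M *m u) u) ->
  inner (M *m x) y ^+ 2 <= inner (M *m x) x * inner (M *m y) y.
Proof.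
move=> symM psdM.
have expand t : 0 <= inner (M *m x) x + 2%:R * t * inner (M *m x) y
                     + t ^+ 2 * inner (M *m y) y.
  have := psdM (x + t *: y).
  rewrite mulmxDr -scalemxAr !innerDl !innerDr !innerZl !innerZr.
  rewrite (_ : inner (M *m y) x = inner (M *m x) y); first lra.
  by rewrite inner_mull symM innerC.
move: (psdM x) (psdM y) expand.
move: (inner (M *m x) x) (inner (M *m x) y) (inner (M *m y) y) => a b c.
move=> a0 c0 H; have [cz|cnz] := eqVneq c 0.
  have [->|bnz] := eqVneq b 0; first by rewrite expr0n mulr_ge0.
  (* With [c = 0] and [b] nonzero the polynomial is affine; this [t] gives it the value [-1]. *)
  have := H (- (a + 1) / (2%:R * b)).
  rewrite cz !mulr0 addr0 (_ : 2%:R * _ * b = - (a + 1)); first lra.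
  by field.
have cpos : 0 < c by rewrite lt_def cnz.
(* The minimiser of the quadratic polynomial. *)
have := H (- b / c); rewrite (_ : _ + _ = (a * c - b ^+ 2) / c); last by field.
by rewrite pmulr_lge0 ?invr_gt0 // subr_ge0 mulrC.
Qed.

End Inner.

Lemma lagrange_interpolation (F : fieldType) (h : F -> F) (s : seq F) :
  uniq s -> exists g : {poly F}, forall a, a \in s -> g.[a] = h a.
Proof.
elim: s => [|a s IHs] /=; first by exists 0.
case/andP=> nas /IHs[g gh].
pose q := \prod_(b <- s) ('X - b%:P).
have qa : q.[a] != 0 by rewrite -/(root q a) root_prod_XsubC.
exists (g + ((h a - g.[a]) / q.[a]) *: q) => b.
rewrite inE hornerD hornerZ => /predU1P[->|bs]; first by field.
have /rootP -> : root q b by rewrite root_prod_XsubC.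
by rewrite mulr0 addr0 gh.
Qed.

Section Spectral.
Variable R : rcfType.

Lemma psd_of_spd n (B : 'M[R]_n) : spd B -> forall u, 0 <= inner (B *m u) u.
Proof.
case=> _ posB u; have [->|/posB/ltW//] := eqVneq u 0.
by rewrite mulmx0 inner0l.
Qed.

(** Write the left eigenvector as [x^T + i y^T] with real [x], [y]. Since [B A B] is symmetric,
    comparing [x^T B A B y] with its transpose leaves [b (|x|_B^2 + |y|_B^2) = 0], where [b] is the
    imaginary part of the eigenvalue. *)
Lemma complex_eigenvalue_real n (A B : 'M[R]_n) (z : R[i]) :
  A^T = A -> spd B ->
  eigenvalue (map_mx (real_complex R) (B *m A)) z -> complex.Im z = 0.
Proof.
move=> symA [symB posB] /eigenvalueP[v vz vn0].
case: z vz => a b vz /=.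
pose x : 'cV[R]_n := \col_i complex.Re (v 0 i).
pose y : 'cV[R]_n := \col_i complex.Im (v 0 i).
have vE : v = map_mx (real_complex R) x^T + 'i%C *: map_mx (real_complex R) y^T.
  apply/rowP => i; rewrite !mxE; case: (v 0 i) => p q /=.
  by rewrite /GRing.add /GRing.mul /=; congr (Complex _ _); ring.
have [ex ey] : x^T *m (B *m A) = a *: x^T - b *: y^T /\
               y^T *m (B *m A) = b *: x^T + a *: y^T.
  move: vz; rewrite vE mulmxDl -scalemxAl -!map_mxM => E.
  by split; apply/rowP => i; move/rowP/(_ i): E; rewrite !mxE;
    set p := \sum_j _; set q := \sum_j _; case=> E1 E2; lra.
have E1 : (x^T *m (B *m A) *m (B *m y)) 0 0 =
    a * (x^T *m (B *m y)) 0 0 - b * (y^T *m (B *m y)) 0 0.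
  by rewrite ex mulmxBl -!scalemxAl !mxE.
have E2 : (y^T *m (B *m A) *m (B *m x)) 0 0 =
    b * (x^T *m (B *m x)) 0 0 + a * (y^T *m (B *m x)) 0 0.
  by rewrite ey mulmxDl -!scalemxAl !mxE.
have symE : (x^T *m (B *m A) *m (B *m y)) 0 0 =
            (y^T *m (B *m A) *m (B *m x)) 0 0.
  transitivity ((x^T *m (B *m A) *m (B *m y))^T 0 0); first by rewrite [RHS]mxE.
  by rewrite !trmx_mul !trmxK symA symB !mulmxA.
have xBy : (x^T *m (B *m y)) 0 0 = (y^T *m (B *m x)) 0 0.
  by rewrite -[LHS]/(inner x (B *m y)) innerC inner_mull symB.
have : b * (inner (B *m x) x + inner (B *m y) y) = 0.
  by rewrite !(innerC (B *m _)) /inner; rewrite xBy in E1; lra.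
move/eqP; rewrite mulf_eq0 => /predU1P[//|].
rewrite paddr_eq0 ?psd_of_spd // => /andP[/eqP xB0 /eqP yB0].
case/negP: vn0; rewrite vE.
have [->|/posB] := eqVneq x 0; last by rewrite xB0 ltxx.
have [->|/posB] := eqVneq y 0; last by rewrite yB0 ltxx.
by rewrite !trmx0 !map_mx0 scaler0 addr0.
Qed.

(** * Functional calculus for [B A] *)

Section Functional.
Variables (n : nat) (A B : 'M[R]_n.+1).
Hypotheses (symA : A^T = A) (spdB : spd B).
Let T := B *m A.

Let symB : B^T = B. Proof. by case: spdB. Qed.

Lemma horner_mx_self_adjoint p : horner_mx T p *m B = B *m (horner_mx T p)^T.
Proof.
have TB : T *m B = B *m T^T by rewrite /T trmx_mul symA symB mulmxA.
elim/poly_ind: p => [|p c IHp]; first by rewrite rmorph0 trmx0 mul0mx mulmx0.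
rewrite [in RHS](mulrC p) !rmorphD !rmorphM /= horner_mx_X horner_mx_C -!mulmxE.
rewrite linearD /= tr_scalar_mx mulmxDl mulmxDr scalar_mxC; congr (_ + _).
by rewrite -mulmxA TB mulmxA IHp -mulmxA (trmx_mul T).
Qed.

(** This plays the role of diagonalizability. If [S ^+ k.+2 = 0], the [B]-energy of a column of
    [(S ^+ k.+1)^T] involves the power [2k + 2 >= k + 2] of [S], hence vanishes, and so does the
    column. *)
Lemma self_adjoint_nilpotent (S : 'M[R]_n.+1) k :
  S *m B = B *m S^T -> S ^+ k.+1 = 0 -> S = 0.
Proof.
move=> SB; elim: k => // k IHk S0; apply: IHk.
have SBk j : S ^+ j *m B = B *m (S ^+ j)^T.
  elim: j => [|j IHj]; first by rewrite expr0 trmx1 mul1mx mulmx1.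
  by rewrite [in LHS]exprS -mulmxE -mulmxA IHj mulmxA SB -mulmxA exprSr trmx_mul.
apply: trmx_inj; apply/matrixP => i j; rewrite trmx0 [RHS]mxE.
suff /colP/(_ i) : (S ^+ k.+1)^T *m delta_mx j 0 = 0 :> 'cV_n.+1.
  by rewrite -colE mxE [_ 0]mxE.
apply/eqP/negPn/negP => /(proj2 spdB).
rewrite mulmxA -SBk -mulmxA inner_mull mulmxA.
rewrite -trmx_mul mulmxE -exprD -addSnnS exprD S0 mul0r.
by rewrite trmx0 mul0mx innerC inner0l ltxx.
Qed.

(** The polynomial splits over the algebraically closed [R[i]], with real roots by
    [complex_eigenvalue_real]. Unlike [spectrum T], the list [s] keeps multiplicities. *)
Lemma char_poly_splits :
  exists2 s, {subset s <= spectrum T} & char_poly T = \prod_(a <- s) ('X - a%:P).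
Proof.
have [s] := closed_field_poly_normal (map_poly (real_complex R) (char_poly T)).
rewrite lead_coef_map (monicP (char_poly_monic T)) rmorph1 scale1r => defs.
have reals z : z \in s -> z = real_complex R (complex.Re z).
  move=> zs; have : complex.Im z = 0.
    apply: (@complex_eigenvalue_real _ A B) => //.
    by rewrite eigenvalue_root_char -map_char_poly defs root_prod_XsubC.
  by case: z {zs} => a b /= ->.
have charT : char_poly T = \prod_(a <- map (@complex.Re R) s) ('X - a%:P).
  apply: (map_poly_inj (real_complex R)); rewrite defs rmorph_prod big_map.
  by apply: eq_big_seq => z /reals {1}->; rewrite rmorphB /= map_polyX map_polyC.
exists (map (@complex.Re R) s) => // a sa.
by rewrite mem_spectrum eigenvalue_root_char charT root_prod_XsubC.
Qed.

(** Every linear factor of [char_poly T] divides [p], so [char_poly T] divides a power of [p]. By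
    Cayley-Hamilton [p(T)] is nilpotent, and being self-adjoint it is zero. *)
Lemma horner_mx_spectrum_eq0 p :
  (forall a, a \in spectrum T -> p.[a] = 0) -> horner_mx T p = 0.
Proof.
move=> p0; have [s sub_s charT] := char_poly_splits.
apply: (@self_adjoint_nilpotent _ (size s)).
  exact: horner_mx_self_adjoint.
rewrite exprS -rmorphXn /=.
have /dvdpP[q ->] : char_poly T %| p ^+ size s.
  rewrite charT; elim: s sub_s {charT} => [|a s IHs] sub_s.
    by rewrite big_nil dvd1p.
  rewrite big_cons exprS dvdp_mul ?IHs //.
    by rewrite dvdp_XsubCl; apply/rootP/p0/sub_s/mem_head.
  by move=> b bs; rewrite sub_s // inE bs orbT.
by rewrite rmorphM /= Cayley_Hamilton !mulr0.
Qed.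

(* Modulo a polynomial vanishing on the spectrum, [p] is the square of the
   Lagrange interpolant of [sqrt p]. *)
Lemma functional_calculus_ge0 p h :
  (forall a, a \in spectrum T -> 0 <= p.[a]) ->
  0 <= inner ((horner_mx T p *m B) *m h) h.
Proof.
move=> p_ge0.
have [g gE] := lagrange_interpolation (fun a => Num.sqrt p.[a])
  (lt_sorted_uniq (spectrum_sorted T)).
have -> : horner_mx T p = horner_mx T (g ^+ 2).
  apply/eqP; rewrite -subr_eq0 -rmorphB /=; apply/eqP.
  apply: horner_mx_spectrum_eq0 => a aT.
  by rewrite hornerD hornerN horner_exp gE // sqr_sqrtr ?p_ge0 ?subrr.
(* Moving one factor [g(T)] across [B] turns the form into the [B]-energy of [g(T)^T h]. *)
rewrite expr2 rmorphM /= -mulmxE -(mulmxA _ _ B) horner_mx_self_adjoint.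
by rewrite -!mulmxA inner_mull psd_of_spd.
Qed.

End Functional.

Variables (n : nat) (A B : 'M[R]_n).
Hypotheses (symA : A^T = A) (psdA : forall u, 0 <= inner (A *m u) u).
Hypothesis (spdB : spd B).
Let symB : B^T = B. Proof. by case: spdB. Qed.

Lemma spectrum_ge0 a : a \in spectrum (B *m A) -> 0 <= a.
Proof.
rewrite mem_spectrum => /eigenvalueP[v vE vn0].
have vB : 0 < inner (B *m v^T) v^T.
  by apply: (proj2 spdB); rewrite -(inj_eq trmx_inj) trmxK trmx0.
rewrite -(pmulr_lge0 _ vB) -innerZl scalemxAr -linearZ /= -vE.
by rewrite !trmx_mul symA symB -!mulmxA inner_mull symB psdA.
Qed.

(** Functional calculus for [M - X], which is nonnegative on the spectrum. *)
Lemma rayleigh_le M h : (forall a, a \in spectrum (B *m A) -> a <= M) ->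
  inner (A *m (B *m h)) (B *m h) <= M * inner (B *m h) h.
Proof.
(* The functional calculus is set up in positive dimension only. *)
case: n A B symA spdB symB h => [|n'] A' B' sA spB sB h leM.
  by rewrite (flatmx0 h) !mulmx0 !inner0l mulr0.
have /(functional_calculus_ge0 sA spB h) :
    forall a, a \in spectrum (B' *m A') -> 0 <= (M%:P - 'X).[a].
  by move=> a aT; rewrite hornerD hornerN hornerC hornerX subr_ge0 leM.
rewrite rmorphB /= horner_mx_X horner_mx_C mulmxBl mul_scalar_mx mulmxBl.
rewrite -scalemxAl -!mulmxA -scaleN1r innerDl !innerZl mulN1r subr_ge0.
by rewrite (inner_mull B' (A' *m _)) sB.
Qed.

(** Functional calculus for [X (X - s)]: the factor [X] takes care of the eigenvalue 0, which [s]
    need not bound from below. *)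
Lemma rayleigh_ge s h :
  (forall a, a \in spectrum (B *m A) -> a != 0 -> s <= a) ->
  s * inner (A *m (B *m h)) (B *m h) <=
  inner (B *m (A *m (B *m h))) (A *m (B *m h)).
Proof.
move=> ges; have T_ge0 := spectrum_ge0.
case: n A B symA spdB symB h T_ge0 ges => [|n'] A' B' sA spB sB h T_ge0 ges.
  by rewrite (flatmx0 h) !mulmx0 !inner0l mulr0.
have /(functional_calculus_ge0 sA spB h) :
    forall a, a \in spectrum (B' *m A') -> 0 <= ('X * ('X - s%:P)).[a].
  move=> a aT; rewrite hornerM hornerD hornerN hornerC hornerX.
  have [->|an0] := eqVneq a 0; first by rewrite mul0r.
  by rewrite mulr_ge0 ?(T_ge0 a) // subr_ge0 ges.
rewrite rmorphM rmorphB /= horner_mx_X horner_mx_C -!mulmxE mulmxBr scalar_mxC.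
rewrite mul_scalar_mx !mulmxBl -!scalemxAl -!mulmxA -scaleN1r innerDl !innerZl.
have adjB u v : inner (B' *m u) v = inner u (B' *m v) by rewrite inner_mull sB.
have adjA u v : inner (A' *m u) v = inner u (A' *m v) by rewrite inner_mull sA.
by rewrite mulN1r subr_ge0 !(adjB _ h) (adjA (B' *m (A' *m _))).
Qed.

End Spectral.

(** * Extreme eigenvalues and comparison of condition numbers *)

Section Kappa.
Variables (R : rcfType) (n : nat) (T : 'M[R]_n).
Implicit Type a : R.

Lemma spectrum_le_last a : a \in spectrum T -> a <= last 0 (spectrum T).
Proof.
move: (spectrum_sorted T); case: (spectrum T) => [|b s] //= sorted_s.
elim/last_ind: s sorted_s => [|s c IHs]; first by rewrite inE => _ /eqP->.
rewrite last_rcons rcons_path -rcons_cons mem_rcons inE.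
case/andP=> /IHs{}IHs lt_c /predU1P[->//|/IHs le_a].
by rewrite ltW // (le_lt_trans le_a).
Qed.

Lemma head_le_spectrum a : a \in spectrum T -> a != 0 ->
  head 0 [seq x <- spectrum T | x != 0] <= a.
Proof.
move=> aT an0.
have : a \in [seq x <- spectrum T | x != 0] by rewrite mem_filter an0.
have := sorted_filter lt_trans (fun x => x != 0) (spectrum_sorted T).
case: [seq _ <- _ | _] => //= b s /(order_path_min lt_trans)/allP lt_b.
by rewrite inE => /predU1P[->//|/lt_b/ltW].
Qed.

Lemma head_nonzero_spectrum :
  let b := head 0 [seq x <- spectrum T | x != 0] in b != 0 -> b \in spectrum T.
Proof.
case E: [seq x <- _ | _] => [|b s] /=; first by rewrite eqxx.
move=> _.
by have := mem_head b s; rewrite -E mem_filter => /andP[].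
Qed.

End Kappa.

Lemma le_kappa (R : rcfType) n p (T : 'M[R]_n) (S : 'M[R]_p) c :
  0 < c ->
  (forall a, a \in spectrum S -> 0 <= a) ->
  (forall a, a \in spectrum T -> a != 0 ->
     [/\ head 0 [seq x <- spectrum S | x != 0] <= a,
         0 <= a & a <= c * last 0 (spectrum S)]) ->
  kappa T <= c * kappa S.
Proof.
move=> c0 S_ge0 H; rewrite /kappa.
move: (@head_nonzero_spectrum _ _ T) (@head_nonzero_spectrum _ _ S) => /=.
move: (@spectrum_le_last _ _ T) (@head_le_spectrum _ _ S).
move: H; set s := head 0 [seq x <- spectrum S | _].
set sM := last 0 (spectrum S).
set t := head 0 _; set tM := last 0 _ => H le_tM s_le t_in s_in.
have sM0 : 0 <= sM.
  have : sM \in 0 :: spectrum S by exact: mem_last.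
  by rewrite inE => /predU1P[->|/S_ge0].
have s0 : 0 <= s by have [->//|/s_in/S_ge0] := eqVneq s 0.
(* If [T] has no nonzero eigenvalue, then [t] is the default 0, and [kappa T = 0] since the inverse
   of 0 is 0. *)
have [->|tn0] := eqVneq t 0.
  by rewrite invr0 mulr0 mulr_ge0 ?divr_ge0 // ltW.
have [s_le_t t0 _] := H t (t_in tn0) tn0.
have tM_gt0 : 0 < tM by rewrite (lt_le_trans _ (le_tM _ (t_in tn0))) // lt_def tn0.
have tM_in : tM \in spectrum T.
  have : tM \in 0 :: spectrum T by exact: mem_last.
  rewrite inE => /predU1P[tM_eq0|//].
  by rewrite tM_eq0 ltxx in tM_gt0.
have [_ _ tM_le] := H tM tM_in (lt0r_neq0 tM_gt0).
have sM_gt0 : 0 < sM by rewrite -(pmulr_rgt0 _ c0) (lt_le_trans tM_gt0).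
have sM_in : sM \in spectrum S.
  have : sM \in 0 :: spectrum S by exact: mem_last.
  rewrite inE => /predU1P[sM_eq0|//].
  by rewrite sM_eq0 ltxx in sM_gt0.
(* The filtered list is not empty, as it contains [sM]; so [s] is a genuine eigenvalue and [s <= t]
   can be inverted. *)
have sn0 : s != 0.
  rewrite /s; have : sM \in [seq x <- spectrum S | x != 0].
    by rewrite mem_filter lt0r_neq0.
  case E: [seq _ <- _ | _] => [|b l] //= _.
  by have := mem_head b l; rewrite -E mem_filter => /andP[].
rewrite mulrA ler_pM ?invr_ge0 ?(ltW tM_gt0) // lef_pV2 // posrE lt_def.
  by rewrite tn0.
by rewrite sn0.
Qed.

(* Nepomnyaschikh's fictitious space lemma. *)
Lemma kappa_auxiliary_space (R : rcfType) n N (A : 'M[R]_n) (AD BD : 'M[R]_N)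
    (Pi : 'M[R]_(n, N)) (P : 'M[R]_(N, n)) c :
  A^T = A -> (forall v, 0 <= inner (A *m v) v) ->
  AD^T = AD -> (forall u, 0 <= inner (AD *m u) u) ->
  spd BD -> Pi *m P = 1%:M -> 0 < c ->
  (forall u, inner (A *m (Pi *m u)) (Pi *m u) <= c * inner (AD *m u) u) ->
  (forall v, inner (AD *m (P *m v)) (P *m v) <= inner (A *m v) v) ->
  kappa (Pi *m BD *m Pi^T *m A) <= c * kappa (BD *m AD).
Proof.
move=> symA psdA symAD psdAD spdBD PiP c0 le_Pi le_P.
have [symBD posBD] := spdBD.
apply: le_kappa => // [|a]; first exact: spectrum_ge0.
rewrite mem_spectrum => /eigenvalueP[w wE wn0] an0.
pose x := w^T; pose g := Pi^T *m x; pose v := Pi *m (BD *m g).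
(* Eigenvectors are rows here: transposing [wE] gives [A B x = a x], and [v] is [B x]. *)
have Av : A *m v = a *: x.
  rewrite /v /g /x -[in RHS]linearZ /= -wE !trmx_mul trmxK symA symBD.
  by rewrite !mulmxA.
have gn0 : g != 0.
  apply: contra wn0 => /eqP g0; rewrite -(inj_eq trmx_inj) trmx0 -/x.
  by rewrite -[x]mul1mx -trmx1 -PiP trmx_mul -mulmxA -/g g0 mulmx0.
pose b := inner (BD *m g) g; have b0 : 0 < b by apply: posBD.
have xv : inner x v = b by rewrite /v innerC inner_mull.
have Avv : inner (A *m v) v = a * b by rewrite Av innerZl xv.
have a0 : 0 <= a by rewrite -(pmulr_lge0 _ b0) -Avv.
split=> //; last first.
  (* Upper bound: [a b = |Pi BD g|_A^2 <= c |BD g|_AD^2], and [rayleigh_le] bounds the last energy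
     by the largest eigenvalue times [b]. *)
  rewrite -(ler_pM2r b0) -Avv (le_trans (le_Pi _)) // -mulrA ler_pM2l //.
  by apply: rayleigh_le => // d; apply: spectrum_le_last.
(* If [AD k = 0], then [Pi k] has zero [A]-energy, so [a <x, Pi k> = <A v, Pi k> = 0]. Thus [g] is
   orthogonal to the kernel of [AD], hence in its range. *)
have g_ker k : AD *m k = 0 -> inner g k = 0.
  move=> ADk; have := cauchy_schwarz v (Pi *m k) symA psdA.
  have -> : inner (A *m (Pi *m k)) (Pi *m k) = 0.
    apply/eqP; rewrite eq_le psdA andbT (le_trans (le_Pi _)) //.
    by rewrite ADk inner0l mulr0.
  rewrite mulr0 Av innerZl real_exprn_even_le0 ?num_real //= mulf_eq0 (negPf an0).
  by rewrite /g inner_mull trmxK => /eqP.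
have [y gE] : exists y, g = AD *m y.
  have /submxP[D gE] : (g^T <= AD)%MS.
    rewrite submxE; move: (mulmx_coker AD); move: (cokermx AD) => K ADK.
    apply/eqP/rowP => i; rewrite [RHS]mxE.
    transitivity (inner g (K *m delta_mx i 0)).
      by rewrite /inner mulmxA -colE [RHS]mxE.
    by apply: g_ker; rewrite mulmxA ADK mul0mx.
  by exists D^T; rewrite -{1}symAD -trmx_mul -gE trmxK.
(* [rayleigh_ge] speaks of vectors of the form [BD h]; all vectors are, [BD] being invertible. *)
have [h yE] : exists h, y = BD *m h.
  suff BDu : BD \in unitmx by exists (invmx BD *m y); rewrite mulKVmx.
  rewrite -row_free_unit -kermx_eq0; apply/rowV0P => u /sub_kermxP uBD.
  apply: trmx_inj; rewrite trmx0; apply/eqP/negPn/negP => /posBD.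
  by rewrite -{1}symBD -trmx_mul uBD trmx0 inner0l ltxx.
set s := head 0 _; pose e := inner (AD *m y) y.
have s0 : 0 <= s.
  by have [->//|/head_nonzero_spectrum/spectrum_ge0] := eqVneq s 0; apply.
have se : s * e <= b.
  rewrite /e /b gE yE; apply: rayleigh_ge => // d; exact: head_le_spectrum.
(* [b = <x, Pi P v> = <AD y, P v>], so Cauchy-Schwarz gives [b^2 <= e |P v|_AD^2 <= e a b]. *)
have be : b <= e * a.
  have := cauchy_schwarz y (P *m v) symAD psdAD.
  rewrite -gE {1}/g inner_mull trmxK mulmxA PiP mul1mx xv => b2.
  rewrite -(ler_pM2r b0) -expr2 (le_trans b2) // -mulrA -Avv gE.
  by rewrite ler_wpM2l ?psdAD.
rewrite -(ler_pM2l b0) (le_trans (y := s * (e * a))) //.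
  by rewrite mulrC ler_wpM2l.
by rewrite mulrA ler_wpM2r.
Qed.

(** * Laplacian energies *)

Section Laplacian.
Variables (R : rcfType) (n : nat) (G : wgraph R n).
Implicit Types u v : 'cV[R]_n.

(** Ordered pairs count each edge twice. This form does not depend on the order of the vertices, so
    it can be regrouped along [orig]. *)
Lemma laplacian_double_sum u : 2%:R * inner (laplacian G *m u) u =
  \sum_i \sum_(j | adj G i j) wt G i j * (u i 0 - u j 0) ^+ 2.
Proof.
under [RHS]eq_bigr => i _ do rewrite (bigID (fun j : 'I_n => i < j)%N) /=.
rewrite big_split /= laplacianP mulr_natl mulr2n; congr (_ + _).
  apply: eq_bigr => i _; apply: eq_big => [j|j _]; first by rewrite andbC.
  by rewrite expr2 mulrA.
rewrite (exchange_big_dep xpredT) //=; apply: eq_bigr => j _.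
apply: eq_big => [i|i _]; last by rewrite wt_sym expr2; ring.
rewrite adj_sym andbC -leqNgt (leq_eqVlt i); case: eqP => //= /val_inj ->.
by rewrite adj_irr.
Qed.

Lemma laplacian_psd u : 0 <= inner (laplacian G *m u) u.
Proof.
rewrite laplacianP; apply: sumr_ge0 => i _; apply: sumr_ge0 => j /andP[_ Gij].
by rewrite -mulrA mulr_ge0 ?(ltW (wt_gt0 Gij)) // -expr2 sqr_ge0.
Qed.

Lemma laplacian_const a : laplacian G *m const_mx a = 0 :> 'cV[R]_n.
Proof.
apply/colP => i; rewrite [RHS]mxE.
set v := laplacian G *m _; have <- : inner v (delta_mx i 0) = v i 0.
  rewrite inner_sum (bigD1 i) //= big1; last first.
    by move=> j ji; rewrite [X in _ * X]mxE (negPf ji) mulr0.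
  by rewrite [X in _ * X]mxE !eqxx mulr1 addr0.
rewrite /v laplacianP big1 // => k _; rewrite big1 // => j _.
by rewrite !mxE subrr mulr0 mul0r.
Qed.

Lemma laplacian_energy0 u x y : connected G ->
  inner (laplacian G *m u) u = 0 -> u x 0 = u y 0.
Proof.
move=> connG E0; have adj_eq i j : adj G i j -> u i 0 = u j 0.
  move=> Gij; have := laplacian_double_sum u; rewrite E0 mulr0 => /esym/eqP.
  have term_ge0 k l : adj G k l -> 0 <= wt G k l * (u k 0 - u l 0) ^+ 2.
    by move=> Gkl; rewrite mulr_ge0 ?sqr_ge0 // ltW // wt_gt0.
  rewrite psumr_eq0 => [/allP/(_ i)|k _]; last exact: sumr_ge0 (term_ge0 k).
  rewrite mem_index_enum psumr_eq0 => [/(_ isT)/allP/(_ j)|l]; last exact: term_ge0.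
  rewrite mem_index_enum Gij mulf_eq0 gt_eqF ?wt_gt0 // => /(_ isT) /=.
  by rewrite sqrf_eq0 subr_eq0 => /eqP.
have /connectP[p Gp ->] := connG x y.
by elim: p x Gp => //= z p IHp x /andP[/adj_eq-> /IHp].
Qed.

End Laplacian.

(** * Deviation from the average on a connected graph *)

Section Average.
Variables (R : rcfType) (d : nat) (H : wgraph R d).
Hypothesis connH : connected H.
Let L := laplacian (unweighted H).
Let psdL := laplacian_psd (unweighted H).
Let symL := tr_laplacian (unweighted H).

(** A kernel vector [x] satisfies [|x|_L^2 + x_j^2 = 0]: it is constant by connectedness and
    vanishes at [j]. *)
Lemma grounded_laplacian_unit j : L + delta_mx j j \in unitmx.
Proof.
have symM : (L + delta_mx j j)^T = L + delta_mx j j.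
  by rewrite linearD /= trmx_delta symL.
rewrite -row_free_unit -kermx_eq0; apply/rowV0P => w /sub_kermxP w0.
pose x := w^T; have : inner ((L + delta_mx j j) *m x) x = 0.
  by rewrite -symM -trmx_mul w0 trmx0 inner0l.
rewrite mulmxDl innerDl -(mul_delta_mx (0 : 'I_1)) -mulmxA.
have -> : inner (delta_mx j (0 : 'I_1) *m (delta_mx 0 j *m x)) x = x j 0 ^+ 2.
  by rewrite inner_mull trmx_delta -rowE /inner mxE big_ord1 !mxE expr2.
move/eqP; rewrite paddr_eq0 ?psdL ?sqr_ge0 // sqrf_eq0 => /andP[/eqP Lx /eqP xj].
apply: trmx_inj; apply/colP => i; rewrite -/x trmx0 [RHS]mxE -xj.
exact: (@laplacian_energy0 _ _ (unweighted H)).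
Qed.

(* With [x = L_j^-1 1] one has [x_j = d], hence [L x = 1 - d e_j], and the
   deviation of [u_j] from the average of [u] is [<L x, u> / d]. *)
Lemma sqr_deviation_le j (u : 'cV[R]_d) :
  (d%:R^-1 * (\sum_p u p 0) - u j 0) ^+ 2 <=
  Wcoef H j * inner (L *m u) u.
Proof.
rewrite /Wcoef -/L; set x := invmx _ *m _.
have Mx : (L + delta_mx j j) *m x = const_mx 1.
  by rewrite mulKVmx // grounded_laplacian_unit.
have Lx : L *m x = const_mx 1 - x j 0 *: delta_mx j 0.
  rewrite -Mx mulmxDl -(mul_delta_mx (0 : 'I_1)) -mulmxA -rowE.
  suff -> : delta_mx j 0 *m row j x = x j 0 *: delta_mx j 0 :> 'cV_d.
    by rewrite addrK.
  by apply/colP => i; rewrite !mxE big_ord1 !mxE mulrC.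
have Lxu v : inner (L *m x) v = \sum_p v p 0 - x j 0 * v j 0.
  rewrite Lx -scaleN1r innerDl !innerZl mulN1r; congr (_ - _ * _).
    by rewrite inner_sum; apply: eq_bigr => p _; rewrite mxE mul1r.
  by rewrite /inner trmx_delta -rowE mxE.
have xj : x j 0 = d%:R.
  (* Pairing [L x] with the constant vector, which [L] kills, gives [0 = d - x_j]. *)
  have := Lxu (const_mx 1); rewrite inner_mull symL laplacian_const innerC inner0l.
  under eq_bigr do rewrite mxE.
  by rewrite sumr_const card_ord [const_mx _ _ _]mxE mulr1 => /esym/subr0_eq.
have dn0 : d%:R != 0 :> R by rewrite pnatr_eq0 -lt0n (leq_ltn_trans _ (ltn_ord j)).
have -> : d%:R^-1 * (\sum_p u p 0) - u j 0 = d%:R^-1 * inner (L *m x) u.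
  by rewrite Lxu xj; field.
rewrite exprMn exprVn -mulrA ler_wpM2l ?invr_ge0 ?exprn_ge0 ?ler0n //.
exact: cauchy_schwarz.
Qed.

End Average.

(** * Disaggregation *)

Section Vertices.
Variables (R : rcfType) (m r : nat) (d : 'I_m -> nat).
Implicit Types (v : 'cV[R]_(m + r)) (u : 'cV[R]_(Dsize r d)).

Lemma big_Dsize (F : 'I_(Dsize r d) -> R) :
  \sum_a F a = \sum_k \sum_p F (@va m r d k p) + \sum_i F (v0 d i).
Proof.
rewrite big_split_ord; congr (_ + _).
by rewrite sig_big_dep (reindex _ tagnat.rank_bij_on); apply: eq_bigr => -[].
Qed.

Lemma orig_lshift (b : 'I_(\sum_(k < m) d k)) :
  orig (lshift r b : 'I_(Dsize r d)) = lshift r (tagnat.sig1 b).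
Proof. by rewrite /orig (unsplitK (inl _)). Qed.

Lemma Dsize_ind (Q : 'I_(Dsize r d) -> Prop) :
  (forall k (p : 'I_(d k)), Q (va r p)) -> (forall i, Q (v0 d i)) ->
  forall a, Q a.
Proof.
move=> Qva Qv0 a; case: (split_ordP a) => [b|i] ->; last exact: Qv0.
by rewrite -(tagnat.sig2K b); apply: Qva.
Qed.

Lemma Pmx_mulE v a : (Pmx R r d *m v) a 0 = v (orig a) 0.
Proof.
have PE x : Pmx R r d a x = (x == orig a)%:R.
  rewrite /Pmx; case: (split_ordP a) => [b|i] ->.
    rewrite orig_lshift; case: (split_ordP x) => [y|y] ->.
      by rewrite block_mxEul !mxE eq_lshift.
    by rewrite block_mxEur mxE eq_rlshift.
  rewrite orig_v0; case: (split_ordP x) => [y|y] ->.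
    by rewrite block_mxEdl mxE eq_lrshift.
  by rewrite block_mxEdr mxE eq_rshift eq_sym.
rewrite mxE (bigD1 (orig a)) //= PE eqxx mul1r big1 ?addr0 // => x nx.
by rewrite PE (negPf nx) mul0r.
Qed.

Definition average_mx : 'M[R]_(Dsize r d, m + r) :=
  block_mx (\mxcol_(k < m) \matrix_(p < d k, l < m) ((d k)%:R^-1 * (l == k)%:R))
    0 0 1%:M.

Lemma Dsmx_sym : (Dsmx R r d)^T = Dsmx R r d.
Proof.
rewrite /Dsmx tr_block_mx !trmx0 trmx1 tr_mxdiag.
by under eq_mxdiag do rewrite tr_scalar_mx.
Qed.

Lemma Dsmx_sqr_P : Dsmx R r d *m (Dsmx R r d *m Pmx R r d) = average_mx.
Proof.
rewrite /Dsmx /Pmx !mulmx_block !mulmx0 !mul0mx !mulmx1 !addr0 !add0r.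
rewrite /average_mx !mul_mxdiag_mxcol; congr block_mx; rewrite ?mulmx0 ?mulmx1 //.
apply: eq_mxcol => k.
rewrite !mul_scalar_mx scalerA -invfM -expr2 sqr_sqrtr ?ler0n //.
by apply/matrixP => p l; rewrite !mxE.
Qed.

Lemma average_kept u i : (average_mx^T *m u) (rshift m i) 0 = u (v0 d i) 0.
Proof.
rewrite mxE big_Dsize big1 ?add0r => [|k _]; last first.
  by rewrite big1 // => p _; rewrite mxE block_mxEur mxE mul0r.
rewrite (bigD1 i) //= mxE block_mxEdr mxE eqxx mul1r big1 ?addr0 // => j ji.
by rewrite mxE block_mxEdr mxE (negPf ji) mul0r.
Qed.

Lemma average_aggregate u k :
  (average_mx^T *m u) (lshift r k) 0 = (d k)%:R^-1 * \sum_p u (@va m r d k p) 0.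
Proof.
rewrite mxE big_Dsize [X in _ + X]big1 ?addr0 => [|i _]; last first.
  by rewrite mxE block_mxEdl mxE mul0r.
rewrite (bigD1 k) //= [X in _ + X]big1 ?addr0 => [|l lk]; last first.
  rewrite big1 // => p _; rewrite mxE block_mxEul !mxE tagnat.Rank1K.
  by rewrite eq_sym (negPf lk) mulr0 mul0r.
rewrite mulr_sumr; apply: eq_bigr => p _.
by rewrite mxE block_mxEul !mxE tagnat.Rank1K eqxx mulr1.
Qed.

Lemma average_PmxK : (forall k, 0 < d k)%N -> average_mx^T *m Pmx R r d = 1%:M.
Proof.
move=> d_gt0; apply/matrixP => x y.
transitivity ((average_mx^T *m (Pmx R r d *m delta_mx y (0 : 'I_1))) x 0).
  by rewrite mulmxA -colE [RHS]mxE.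
transitivity ((delta_mx y 0 : 'cV[R]_(m + r)) x 0); last by rewrite !mxE andbT.
case: (split_ordP x) => [k|i] ->; last by rewrite average_kept Pmx_mulE orig_v0.
rewrite average_aggregate.
under eq_bigr do rewrite Pmx_mulE orig_va.
rewrite sumr_const card_ord -(mulr_natl (delta_mx _ _ _ _)) mulKf //.
by rewrite pnatr_eq0 -lt0n.
Qed.

End Vertices.

(** * Comparison of the energies of the two graphs *)

Section Energy.
Variables (R : rcfType) (m r : nat) (d : 'I_m -> nat).
Variables (G : wgraph R (m + r)) (Ga : forall k, wgraph R (d k)).
Variable GD : wgraph R (Dsize r d).
Hypothesis disG : disaggregation G Ga GD.
Implicit Types (v : 'cV[R]_(m + r)) (u : 'cV[R]_(Dsize r d)).

Definition external (a b : 'I_(Dsize r d)) := adj GD a b && (orig a != orig b).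

Lemma external_sym a b : external a b = external b a.
Proof. by rewrite /external adj_sym eq_sym. Qed.

(** Over ordered pairs, hence twice the energy of the external edges. *)
Definition external_energy u :=
  \sum_a \sum_(b | external a b) wt GD a b * (u a 0 - u b 0) ^+ 2.

Definition restrict u k : 'cV[R]_(d k) := \col_p u (va r p) 0.

(** Group the external pairs by the origins of their endpoints: by [dis_ext] each class over an edge
    of [G] is a single pair. *)
Lemma sum_adj_external (F : 'I_(m + r) -> 'I_(m + r) -> R) :
  \sum_x \sum_(y | adj G x y) F x y =
  \sum_a \sum_(b | external a b) F (orig a) (orig b).
Proof.
rewrite !pair_big_dep /=.
rewrite [RHS](partition_big (fun f => (orig f.1, orig f.2))
  (fun e => adj G e.1 e.2)) /=; last first.
  by move=> [a b] /andP[/(dis_ext_adj disG) H /H[]].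
apply: eq_bigr => -[x y] /= Gxy.
have [[a b] [[/= oa ob GDab] uniq_ab]] := dis_ext disG Gxy.
rewrite (big_pred1 (a, b)) /= ?oa ?ob // => -[a' b'].
rewrite /external /=; apply/idP/idP.
  case/andP=> /andP[GDab' _] /eqP[oa' ob'].
  by apply/eqP/esym/uniq_ab; split.
move/eqP=> [-> ->]; rewrite oa ob GDab eqxx !andbT /=.
by apply: contraTneq Gxy => ->; rewrite adj_irr.
Qed.

Lemma laplacian_external v : 2%:R * inner (laplacian G *m v) v =
  \sum_a \sum_(b | external a b)
    wt GD a b * (v (orig a) 0 - v (orig b) 0) ^+ 2.
Proof.
rewrite laplacian_double_sum sum_adj_external.
apply: eq_bigr => a _; apply: eq_bigr => b /andP[GDab oab].
by have [_ ->] := dis_ext_adj disG GDab oab.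
Qed.

Lemma laplacian_split u : 2%:R * inner (laplacian GD *m u) u =
  external_energy u +
  2%:R * \sum_k inner (laplacian (Ga k) *m restrict u k) (restrict u k).
Proof.
rewrite laplacian_double_sum.
under eq_bigr => a _ do rewrite (bigID (fun b => orig a != orig b)) /=.
rewrite big_split /=; congr (_ + _).
rewrite big_Dsize [X in _ + X]big1 ?addr0 => [|i _]; last first.
  (* A kept vertex shares its origin with no other vertex. *)
  apply: big_pred0 => b; elim/Dsize_ind: b => [k p|j].
    by rewrite orig_v0 orig_va eq_rlshift andbF.
  rewrite !orig_v0 eq_rshift negbK andbC; case: eqP => //= ->.
  exact: adj_irr.
rewrite mulr_sumr; apply: eq_bigr => k _; rewrite laplacian_double_sum.
apply: eq_bigr => p _; rewrite big_mkcond big_Dsize [X in _ + X]big1 ?addr0.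
  rewrite (bigD1 k) //= [X in _ + X]big1 ?addr0 => [|l lk]; last first.
    rewrite big1 // => q _.
    by rewrite !orig_va eq_lshift eq_sym lk andbF.
  rewrite [RHS]big_mkcond; apply: eq_bigr => q _.
  rewrite !orig_va eqxx andbT (dis_int_adj disG) !mxE.
  by case: ifP => // Gpq; rewrite (dis_int_wt disG Gpq).
by move=> i _; rewrite orig_v0 orig_va eq_lrshift andbF.
Qed.

(** [P v] is constant on each aggregate, so internal edges contribute nothing, and external edges
    see the same differences as in [G]. *)
Lemma prolongation_energy v :
  inner (laplacian GD *m (Pmx R r d *m v)) (Pmx R r d *m v) =
  inner (laplacian G *m v) v.
Proof.
apply: (@mulfI _ 2%:R); first by rewrite pnatr_eq0.
rewrite laplacian_split laplacian_external [X in _ + X](_ : _ = 0) ?addr0.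
  by do 2!apply: eq_bigr => ? _; rewrite !Pmx_mulE.
rewrite big1 ?mulr0 // => k _.
rewrite (_ : restrict _ k = const_mx (v (lshift r k) 0)).
  by rewrite laplacian_const inner0l.
by apply/colP => p; rewrite [LHS]mxE [RHS]mxE Pmx_mulE orig_va.
Qed.

(** The coefficient of [Wcoef (Ga k) p] in [Wmin], up to [1 + eps^-1]: a weighted external degree in
    which edges to other aggregates count twice. *)
Definition degree_bound (k : 'I_m) (p : 'I_(d k)) : R :=
  \sum_(i < r | adj GD (v0 d i) (va r p)) wt GD (v0 d i) (va r p) +
  2%:R * \sum_l \sum_(q < d l | (l != k) && adj GD (va r p) (va r q))
    wt GD (va r p) (va r q).

(* [E2] contains exactly one orientation of each edge between aggregates. *)
Lemma Wmin_degree_bound E2 eps k : orients_cross_edges GD E2 ->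
  Wmin Ga GD E2 eps k =
  (1 + eps^-1) * \sum_p degree_bound p * Wcoef (Ga k) p.
Proof.
move=> orE2; rewrite /Wmin; congr (_ * _).
under [RHS]eq_bigr do rewrite /degree_bound mulrDl.
rewrite [RHS]big_split /=; congr (_ + _).
  rewrite (exchange_big_dep xpredT) //=; apply: eq_bigr => p _.
  by rewrite mulr_suml.
under [in RHS]eq_bigr do rewrite -mulrA mulr_suml.
rewrite -mulr_sumr exchange_big /=; congr (_ * _); apply: eq_bigr => l _.
rewrite [X in _ + X](exchange_big_dep xpredT) //= -big_split /=.
apply: eq_bigr => p _; rewrite mulr_suml.
rewrite ![\sum_(_ | _ \in _) _]big_mkcond -big_split [RHS]big_mkcond /=.
apply: eq_bigr => q _; rewrite (wt_sym GD (va r q)).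
have cross a b : (a, b) \in E2 -> adj GD a b && (orig a != orig b).
  case/(E2_cross orE2) => k' [l' [p' [q' [kl -> -> ->]]]].
  by rewrite !orig_va eq_lshift.
(* On an edge between aggregates exactly one of the two memberships in [E2] holds; on any other pair
   neither does. *)
have [/andP[lk GDpq]|] := boolP (_ && _).
  rewrite eq_sym in lk; have := E2_once orE2 lk GDpq.
  by do 2!case: (_ \in E2) => //=; rewrite ?addr0 ?add0r.
have [/cross/andP[->]|_] := boolP (_ \in E2).
  by rewrite !orig_va eq_lshift eq_sym => ->.
have [/cross/andP[]|_] := boolP (_ \in E2); last by rewrite addr0.
by rewrite !orig_va eq_lshift adj_sym => -> ->.
Qed.


Definition deviation u a : R :=
  ((average_mx R r d)^T *m u) (orig a) 0 - u a 0.

Lemma deviation_kept u i : deviation u (v0 d i) = 0.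
Proof. by rewrite /deviation orig_v0 average_kept subrr. Qed.

Lemma sqr_deviation_aggregate u k (p : 'I_(d k)) :
  deviation u (va r p) ^+ 2 <= Wcoef (Ga k) p *
    inner (laplacian (unweighted (Ga k)) *m restrict u k) (restrict u k).
Proof.
have conn_k : connected (Ga k) by exact: (dis_conn disG).
have := sqr_deviation_le conn_k p (restrict u k).
rewrite mxE /deviation orig_va average_aggregate.
by under eq_bigr do rewrite mxE.
Qed.

(* Weight of [deviation u a ^+ 2] on an external edge [(a, b)]: the deviation
   vanishes on kept vertices, so the factor 2 is lost only between aggregates. *)
Definition edge_share (b : 'I_(Dsize r d)) : R := 1 + (orig b < m)%N%:R.

Lemma edge_share_va k (p : 'I_(d k)) : edge_share (va r p) = 2%:R.
Proof. by rewrite /edge_share orig_va /= ltn_ord. Qed.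

Lemma edge_share_v0 i : edge_share (v0 d i) = 1.
Proof. by rewrite /edge_share orig_v0 /= ltnNge leq_addr addr0. Qed.

Lemma sqr_deviation_diff u a b :
  (deviation u a - deviation u b) ^+ 2 <=
  edge_share b * deviation u a ^+ 2 + edge_share a * deviation u b ^+ 2.
Proof.
elim/Dsize_ind: a => [k p|i]; elim/Dsize_ind: b => [l q|j];
  rewrite ?edge_share_va ?edge_share_v0 ?deviation_kept.
- by move: (deviation _ _) (deviation _ _) => x y; have := sqr_ge0 (x + y); lra.
- by have := sqr_ge0 (deviation u (va r p)); lra.
- by have := sqr_ge0 (deviation u (va r q)); lra.
by rewrite !subrr expr0n mulr0 addr0.
Qed.

Lemma sum_edge_share k (p : 'I_(d k)) :
  \sum_(b | external (va r p) b) wt GD (va r p) b * edge_share b =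
  degree_bound p.
Proof.
rewrite /degree_bound addrC big_mkcond big_Dsize; congr (_ + _).
  rewrite mulr_sumr; apply: eq_bigr => l _.
  rewrite mulr_sumr [RHS]big_mkcond; apply: eq_bigr => q _.
  by rewrite /external !orig_va eq_lshift edge_share_va andbC (eq_sym k) mulrC.
rewrite [RHS]big_mkcond; apply: eq_bigr => i _.
rewrite /external orig_va orig_v0 eq_lrshift andbT edge_share_v0 mulr1.
by rewrite adj_sym wt_sym.
Qed.

Lemma degree_bound_ge0 k (p : 'I_(d k)) : 0 <= degree_bound p.
Proof.
rewrite addr_ge0 ?mulr_ge0 ?ler0n //; first by apply: sumr_ge0 => i /wt_gt0/ltW.
by apply: sumr_ge0 => l _; apply: sumr_ge0 => q /andP[_ /wt_gt0/ltW].
Qed.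

(** Charge each edge's bound from [sqr_deviation_diff] to its two endpoints. Both charges have the
    same total by symmetry, and the charges at a vertex add up to [degree_bound]. *)
Lemma external_deviation_energy u :
  \sum_a \sum_(b | external a b)
    wt GD a b * (deviation u a - deviation u b) ^+ 2 <=
  2%:R * \sum_k (\sum_p degree_bound p * Wcoef (Ga k) p) *
    inner (laplacian (unweighted (Ga k)) *m restrict u k) (restrict u k).
Proof.
pose share a b := wt GD a b * edge_share b * deviation u a ^+ 2.
have share_sym : \sum_a \sum_(b | external a b) share b a =
                 \sum_a \sum_(b | external a b) share a b.
  rewrite (exchange_big_dep xpredT) //=; apply: eq_bigr => b _.
  by apply: eq_bigl => a; rewrite external_sym.
have share_le : \sum_a \sum_(b | external a b) share a b <=
    \sum_k (\sum_p degree_bound p * Wcoef (Ga k) p) *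
    inner (laplacian (unweighted (Ga k)) *m restrict u k) (restrict u k).
  rewrite big_Dsize [X in _ + X]big1 ?addr0 => [|i _]; last first.
    by rewrite big1 // => b _; rewrite /share deviation_kept expr0n mulr0.
  apply: ler_sum => k _; rewrite mulr_suml; apply: ler_sum => p _.
  rewrite /share -mulr_suml sum_edge_share -mulrA.
  by rewrite ler_wpM2l ?degree_bound_ge0 ?sqr_deviation_aggregate.
rewrite mulr_natl mulr2n; apply: le_trans (lerD share_le share_le).
rewrite -{2}share_sym -big_split /=; apply: ler_sum => a _.
rewrite -big_split; apply: ler_sum => b /andP[/wt_gt0/ltW w_ge0 _].
rewrite /share (wt_sym GD b a) -!mulrA /= -mulrDr ler_wpM2l //.
exact: sqr_deviation_diff.
Qed.

Lemma average_energy E2 eps u : orients_cross_edges GD E2 -> 0 < eps ->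
  (forall k (p q : 'I_(d k)),
     adj (Ga k) p q -> Wmin Ga GD E2 eps k <= wt (Ga k) p q) ->
  inner (laplacian G *m ((average_mx R r d)^T *m u)) ((average_mx R r d)^T *m u)
    <= (1 + eps) * inner (laplacian GD *m u) u.
Proof.
move=> orE2 eps0 heavy; set w := _ *m u.
rewrite -(ler_pM2l (ltr0Sn R 1)) mulrCA.
rewrite laplacian_split laplacian_external.
set I := \sum_k inner _ _.
have I0 : 0 <= I by apply: sumr_ge0 => k _; exact: laplacian_psd.
pose D := \sum_a \sum_(b | external a b)
    wt GD a b * (deviation u a - deviation u b) ^+ 2.
have young : \sum_a \sum_(b | external a b)
    wt GD a b * (w (orig a) 0 - w (orig b) 0) ^+ 2 <=
    (1 + eps) * external_energy u + (1 + eps^-1) * D.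
  rewrite /external_energy /D !mulr_sumr -big_split; apply: ler_sum => a _ /=.
  rewrite !mulr_sumr -big_split; apply: ler_sum => b /andP[/wt_gt0/ltW w_ge0 _] /=.
  rewrite 2![_ * (wt _ _ _ * _)]mulrCA -mulrDr ler_wpM2l //.
  rewrite (_ : w _ _ - _ = (u a 0 - u b 0) + (deviation u a - deviation u b)).
    move: (u a 0 - u b 0) (deviation _ _ - _) => s t.
    (* The defect in Young's inequality is a square divided by [eps]. *)
    rewrite -subr_ge0 (_ : _ - _ = (eps * s - t) ^+ 2 / eps).
      by rewrite divr_ge0 ?sqr_ge0 // ltW.
    by field; rewrite gt_eqF.
  by rewrite /deviation -/w; ring.
have internal : (1 + eps^-1) * D <= 2%:R * I.
  have c0 : 0 <= 1 + eps^-1 by rewrite addr_ge0 ?ler01 // invr_ge0 ltW.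
  apply: le_trans (ler_wpM2l c0 (external_deviation_energy u)) _.
  rewrite mulrCA ler_pM2l // mulr_sumr; apply: ler_sum => k _.
  rewrite mulrA -(Wmin_degree_bound _ _ orE2) !laplacianP mulr_sumr.
  move: (Wmin _ _ _ _ _) (heavy k) => W heavy_k.
  apply: ler_sum => p _; rewrite mulr_sumr; apply: ler_sum => q /andP[_ Gpq] /=.
  by rewrite mul1r -!mulrA ler_wpM2r ?heavy_k // -expr2 sqr_ge0.
(* The deviations cost at most [2 I], while the right-hand side offers [2 (1 + eps) I]. *)
have := mulr_ge0 (ltW eps0) I0; lra.
Qed.

End Energy.

Theorem theorem12 (R : rcfType) (m r : nat) (d : 'I_m -> nat)
  (G : wgraph R (m + r)) (Ga : forall k : 'I_m, wgraph R (d k))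
  (GD : wgraph R (Dsize r d))
  (E2 : {set 'I_(Dsize r d) * 'I_(Dsize r d)})
  (eps : R) (BD : 'M[R]_(Dsize r d)) :
  (2 <= m + r)%N ->
  connected G ->
  disaggregation G Ga GD ->
  orients_cross_edges GD E2 ->
  0 < eps ->
  (forall (k : 'I_m) (p q : 'I_(d k)),
     adj (Ga k) p q -> Wmin Ga GD E2 eps k <= wt (Ga k) p q) ->
  spd BD ->
  let A := laplacian G in
  let AD := laplacian GD in
  let Ds := Dsmx R r d in
  let Pt := Ds *m Pmx R r d in
  let BDt := Ds *m BD *m Ds in
  let B := Pt^T *m BDt *m Pt in
  kappa (B *m A) <= (1 + eps) * kappa (BD *m AD).
Proof.
move=> _ _ disG orE2 eps0 heavy spdBD; cbv zeta.
set B := _^T *m _ *m _.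
have -> : B = (average_mx R r d)^T *m BD *m (average_mx R r d)^T^T.
  by rewrite trmxK -Dsmx_sqr_P (trmx_mul (Dsmx R r d)) Dsmx_sym /B !mulmxA.
apply: (kappa_auxiliary_space (P := Pmx R r d)) => //.
- exact: tr_laplacian.
- exact: laplacian_psd.
- exact: tr_laplacian.
- exact: laplacian_psd.
- by apply: average_PmxK => k; apply: dis_pos disG k.
- by rewrite addr_gt0.
- by move=> u; apply: average_energy orE2 eps0 heavy.
by move=> v; rewrite (prolongation_energy disG).
Qed.
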